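(* Let $1\le p<+\infty$. Then for every $f\in L^p[0,\pi]$, $$\lim_{n\to\infty}\|\mathcal{GK}_n(f)-f\|_p=0,$$ where $\|\cdot\|_p$ is the norm of $L^p[0,\pi]$ and $\mathcal{GK}_n$ is the $n$-th Grünwald–Kantorovich operator.
   Context: For $n\in\mathbb{N}$ and $k=1,\dots,n$ let $\theta_k^{(n)}=\frac{(2k-1)\pi}{2n}$ and, for real $\theta$, let $$P_k(\theta)=(-1)^{k+1}\frac{\cos(n\theta)\sin\theta_k^{(n)}}{n(\cos\theta-\cos\theta_k^{(n)})}$$ (the dependence on $n$ is suppressed; $P_k$ is extended by continuity at the removable singularities, so it is a polynomial in $\cos\theta$, namely the fundamental Lagrange polynomial at the Chebyshev nodes $\cos\theta_k^{(n)}$ evaluated at $\cos\theta$). The Grünwald–Kantorovich operators are defined for integrable $f$ on $[0,\pi]$ and $\theta\in[0,\pi]$ by $$\mathcal{GK}_n(f)(\theta)=\frac{n}{\pi}\sum_{k=1}^n\left(\int_{\theta_k^{(n)}}^{\theta_k^{(n)}+\frac{\pi}{2n}}f(t)\,dt\right)\left\{P_k\left(\theta+\frac{\pi}{2n}\right)+P_k\left(\theta-\frac{\pi}{2n}\right)\right\}.$$ *)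

(* Defs.v *)
From HB Require Import structures.
From mathcomp Require Import all_boot all_order all_algebra.
From mathcomp Require Import all_classical all_reals all_analysis.
From mathcomp Require Import ring lra.
Set Implicit Arguments.
Unset Strict Implicit.
Unset Printing Implicit Defensive.
Import Order.TTheory GRing.Theory Num.Theory.
Import numFieldNormedType.Exports.
Local Open Scope classical_set_scope.
Local Open Scope ring_scope.

Definition cheb_angle {R : realType} (n k : nat) : R :=
  (2 * k%:R - 1) * pi / (2 * n%:R).

Definition lagrange_quot {R : realType} (n k : nat) (theta : R) : R :=
  (-1) ^+ k.+1 * (cos (n%:R * theta) * sin (cheb_angle n k))
  / (n%:R * (cos theta - cos (cheb_angle n k))).

(* The singularities of [lagrange_quot n k] are removable with value 1; see
   [lagrangeP_continuous] below. *)
Definition lagrangeP {R : realType} (n k : nat) (theta : R) : R :=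
  if cos theta == cos (cheb_angle n k) then 1 else lagrange_quot n k theta.

Definition GK {R : realType} (n : nat) (f : R -> R) (theta : R) : R :=
  n%:R / pi *
  \sum_(1 <= k < n.+1)
    (\int[lebesgue_measure]_(t in
        `[cheb_angle n k, cheb_angle n k + pi / (2 * n%:R)]) f t) *
    (lagrangeP n k (theta + pi / (2 * n%:R)) +
     lagrangeP n k (theta - pi / (2 * n%:R))).

(* Functions and norms of L^p[0, pi] are read off the zero extension outside
   [0, pi], so that [f] itself is unconstrained there. *)
Definition in_Lp0pi {R : realType} (p : R) (f : R -> R) : bool :=
  (f \_ `[0, pi]) \in Lfun (@lebesgue_measure R) p%:E.

Definition Lp0pi_norm {R : realType} (p : R) (f : R -> R) : \bar R :=
  'N[@lebesgue_measure R]_(p%:E)[EFin \o (f \_ `[0, pi])%R]%E.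

Section lagrangeP_continuous.
Context {R : realType}.
Implicit Types (a b x : R) (n k : nat).

Lemma cos_sin_natmul n a b : cos a = cos b ->
  cos (n%:R * a) = cos (n%:R * b) /\
  exists u, sin (n%:R * a) = sin a * u /\ sin (n%:R * b) = sin b * u.
Proof.
move=> ab; elim: n => [|n [IHc [u [IHa IHb]]]].
  by split; [rewrite !mul0r | exists 0; rewrite !mul0r !mulr0 sin0].
have s2 : sin a ^+ 2 = sin b ^+ 2 by rewrite !sin2cos2 ab.
rewrite -!natr1 !mulrDl !mul1r !cosD !sinD IHc IHa IHb ab; split.
  by ring: s2.
by exists (u * cos b + cos (n%:R * b)); split; ring.
Qed.

Lemma cos_sin_cheb n k : (0 < k)%N -> (0 < n)%N ->
  cos (n%:R * cheb_angle n k) = 0 :> R /\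
  sin (n%:R * cheb_angle n k) = (-1) ^+ k.+1 :> R.
Proof.
move=> k0 n0.
have n0' : n%:R != 0 :> R by rewrite pnatr_eq0 -lt0n.
have -> : n%:R * cheb_angle n k = (2 * k%:R - 1) * pi / 2 :> R.
  by rewrite /cheb_angle; field.
case: k k0 => // k _; elim: k => [|k [IHc IHs]].
  rewrite (_ : _ / 2 = pi / 2) ?cos_pihalf ?sin_pihalf ?sqrrN ?expr1n//.
  by field.
rewrite (_ : _ / 2 = (2 * k.+1%:R - 1) * pi / 2 + pi).
  by rewrite cosDpi sinDpi IHc IHs oppr0; split=> //; rewrite [RHS]exprS mulN1r.
by rewrite -(natr1 k.+1); field.
Qed.

Lemma sin_cheb_gt0 n k : (0 < k <= n)%N -> 0 < sin (cheb_angle n k) :> R.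
Proof.
move=> /andP[k0 kn].
have n0 : 0 < n%:R :> R by rewrite ltr0n (leq_trans k0).
have k1 : 1 <= k%:R :> R by rewrite ler1n.
have kn' : k%:R <= n%:R :> R by rewrite ler_nat.
have pi0 := @pi_gt0 R.
apply: sin_gt0_pi; rewrite /cheb_angle; apply/andP; split.
  by apply: divr_gt0; [apply: mulr_gt0 => //; lra | apply: mulr_gt0].
by rewrite ltr_pdivrMr; [rewrite mulrC ltr_pM2l //; lra | apply: mulr_gt0].
Qed.

Lemma lagrangeP_continuous n k : (0 < k <= n)%N ->
  continuous (@lagrangeP R n k).
Proof.
move=> kn x; have /andP[k0 kn'] := kn.
have n0 : (0 < n)%N by exact: leq_trans kn'.
have n0' : n%:R != 0 :> R by rewrite pnatr_eq0 -lt0n.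
have ccos : continuous (fun y : R => cos (n%:R * y)).
  move=> y; apply: continuous_comp; last exact: continuous_cos.
  exact: mulrl_continuous.
have [xk|xk] := eqVneq (cos x) (cos (cheb_angle n k)); last first.
  have nxk : \forall y \near x, lagrange_quot n k y = lagrangeP n k y.
    have : \forall y \near x, cos y != cos (cheb_angle n k).
      have /cvgr_neq0 : cos y - cos (cheb_angle n k) @[y --> x] -->
          cos x - cos (cheb_angle n k).
        by apply: cvgB; [exact: continuous_cos | exact: cvg_cst].
      rewrite subr_eq0 => /(_ xk); apply: filterS => y.
      by rewrite subr_eq0.
    by apply: filterS => y yk; rewrite /lagrangeP (negbTE yk).
  rewrite /continuous_at {2}/lagrangeP (negbTE xk).
  apply: cvg_trans (near_eq_cvg nxk) _.
  apply: cvgM.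
    by apply: cvgM; [exact: cvg_cst | apply: cvgM; [exact: ccos | exact: cvg_cst]].
  apply: cvgV; first by rewrite mulf_neq0// subr_eq0.
  apply: cvgM; first exact: cvg_cst.
  by apply: cvgB; [exact: continuous_cos | exact: cvg_cst].
have [cnk snk] := @cos_sin_cheb n k k0 n0.
have sk0 := sin_cheb_gt0 kn.
have [cnx [u [snx snk']]] := cos_sin_natmul n xk.
rewrite cnk in cnx; rewrite snk in snk'.
have sx0 : sin x != 0.
  by rewrite -sqrf_eq0 sin2cos2 xk -sin2cos2 sqrf_eq0 gt_eqF.
have /is_derive1_caratheodory[g [gE gc gx]] := is_derive_cos (n%:R * x).
have /is_derive1_caratheodory[h [hE hc hx]] := is_derive_cos x.
have hx0 : h x != 0 by rewrite hx oppr_eq0.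
pose F y := (-1) ^+ k.+1 * (g (n%:R * y) * sin (cheb_angle n k)) / h y.
have Fx : F x = 1.
  rewrite /F gx hx snx mulNr mulrN invrN mulrNN mulrAC.
  rewrite (_ : _ * _ = (-1) ^+ k.+1 * (sin (cheb_angle n k) * u)).
    by rewrite -snk' -expr2 sqrr_sign.
  by field.
have nF : \forall y \near x, F y = lagrangeP n k y.
  have /cvgr_neq0/(_ hx0) : h y @[y --> x] --> h x by exact: hc.
  apply: filterS => y hy0.
  have [->|yx] := eqVneq y x; first by rewrite Fx /lagrangeP xk eqxx.
  have yx0 : y - x != 0 by rewrite subr_eq0.
  rewrite /lagrangeP -xk -subr_eq0 hE mulf_eq0 (negbTE hy0) (negbTE yx0)/=.
  have cny := gE (n%:R * y); rewrite cnx subr0 -mulrBr in cny.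
  by rewrite /lagrange_quot -xk hE cny /F; field; rewrite n0' hy0 yx0.
rewrite /continuous_at -(nbhs_singleton nF).
apply: cvg_trans (near_eq_cvg nF) _.
apply: cvgM; last exact: cvgV.
apply: cvgM; first exact: cvg_cst.
apply: cvgM; last exact: cvg_cst.
apply: (@continuous_comp _ _ _ (fun y : R => n%:R * y) g) => //.
exact: mulrl_continuous.
Qed.
End lagrangeP_continuous.

(* Main.v *)
Require Import Defs.
From mathcomp Require Import all_boot all_order all_algebra.
From mathcomp Require Import all_classical all_reals all_analysis measurable_realfun.
From mathcomp Require Import ring lra zify.
Import Order.TTheory GRing.Theory Num.Theory.
Import numFieldNormedType.Exports.
Local Open Scope classical_set_scope.
Local Open Scope ring_scope.

(* Put h = pi / (2n). By Christoffel-Darboux, P_k is the cosine sum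
   n^-1 (1 + 2 sum_(0 < j < n) cos (j theta_k) cos (j theta)), so that
     P_k (theta + h) + P_k (theta - h) = P_1 (theta - theta_k) + P_1 (theta + theta_k).
   The even function P_1 decays quadratically: |P_1 x| is at most
   h / (n (cos h - cos x)) away from the origin, hence the kernel is O((1 + |i - k|)^-2)
   when theta is in the i-th of the n equal cells of [0, pi]. Young's inequality and a Schur test
   on this matrix of bounds give ||GK_n u||_p <= 384 ||u||_p. As the P_k sum to 1,
   the same decay gives uniform convergence for continuous functions, which are dense. *)

(** * The kernel of the operators *)

(** A single P_k decays in general only like 1 / |i - k|, which is not summable. After the two
    shifted values are rewritten through P_1, the numerator carries sin theta_1 = sin h, of order
    1/n, in place of sin theta_k: this supplies the second power. Each integral runs over half a
    cell, of mass 1/2 after multiplication by n / pi, while the kernels sum to 2; hence constants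
    are reproduced. The first moment of weights of size (1 + d)^-2 diverges, so a continuous
    function is given an affine modulus e + K |x - y|: the total weight multiplies e, and the
    moment, of order o(n), is divided by n. Density starts from L^1: between functions bounded by M,
    the p-th power of the L^p distance is at most (2M)^(p-1) times the L^1 distance, so f is
    truncated first. *)

Section trigonometry.
Context {R : realType}.
Implicit Types (a b u x y t : R) (i j k m n : nat).

Lemma mul2_cos_cos a b : 2 * (cos a * cos b) = cos (a - b) + cos (a + b).
Proof. by rewrite cosB cosD; ring. Qed.

Lemma le_sin u : 0 <= u -> sin u <= u.
Proof.
move=> u0; have [|c _] := @MVT_segment R sin cos 0 u u0 (fun x _ => is_derive_sin x).
  exact/continuous_subspaceT/continuous_sin.
by rewrite sin0 !subr0 => ->; rewrite ler_piMl// cos_le1.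
Qed.

Lemma cos_halfE x : cos x = 1 - 2 * sin (x / 2) ^+ 2.
Proof. by rewrite {1}[x]splitr cosD -!expr2 cos2sin2; ring. Qed.

Lemma cos_ge_half x : 0 <= x <= 1 -> 1 / 2 <= cos x.
Proof.
move=> /andP[x0 x1]; rewrite cos_halfE.
have xp : 0 <= x / 2 <= pi by have p2 := @pi_ge2 R; apply/andP; split; lra.
have s0 := sin_ge0_pi xp; have s1 : sin (x / 2) <= x / 2 by apply: le_sin; lra.
have : sin (x / 2) ^+ 2 <= (1 / 2) ^+ 2 by rewrite ler_sqr ?nnegrE; lra.
lra.
Qed.

(** On [0, 1] the slope cos is at least 1/2. Beyond 1, monotonicity gives sin u >= sin 1 >= 1/2 >= u
    / 4, because u <= pi / 2 < 2. *)
Lemma sin_ge u : 0 <= u <= pi / 2 -> u / 4 <= sin u.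
Proof.
have pi2 := @pi_ge2 R; have := @pihalf_lt2 R => ph2.
have main (v : R) : 0 <= v <= 1 -> v / 2 <= sin v.
  move=> /andP[v0 v1]; have [|c cv] := @MVT_segment R sin cos 0 v v0 (fun x _ => is_derive_sin x).
    exact/continuous_subspaceT/continuous_sin.
  rewrite sin0 !subr0 => ->; rewrite mulrC ler_wpM2r//.
  move: cv; rewrite in_itv/= => /andP[c0 cv].
  by have := @cos_ge_half c; rewrite c0 (le_trans cv v1) mul1r => /(_ isT).
move=> /andP[u0 u1]; have [u2|u2] := leP u 1.
  by have := main u; rewrite u0 u2 => /(_ isT); lra.
have s1 := main 1; rewrite ler01 lexx in s1.
apply: (@le_trans _ _ (sin 1)); first by have := s1 isT; lra.
by rewrite ltW// ltr_sin ?in_itv//=; apply/andP; split; lra.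
Qed.

Lemma cheb_angleE n k : @cheb_angle R n k.+1 = (2 * k%:R + 1) * (pi / (2 * n%:R)).
Proof. by rewrite /cheb_angle -natr1 mulrA; congr (_ * _ / _); ring. Qed.

(** The three-term recurrence [step] makes each new term of the sum the difference of consecutive
    right-hand sides. *)
Lemma christoffel_darboux a b n : (0 < n)%N ->
  (cos a - cos b) * (1 + \sum_(1 <= j < n) 2 * (cos (j%:R * b) * cos (j%:R * a))) =
  cos (n%:R * a) * cos (n.-1%:R * b) - cos (n.-1%:R * a) * cos (n%:R * b).
Proof.
case: n => // n _; elim: n => [|n IH].
  by rewrite big_geq// !mul1r !mul0r cos0; ring.
rewrite big_nat_recr//= addrA mulrDr IH/=.
have step (c : R) : cos (n.+2%:R * c) = 2 * (cos (n.+1%:R * c) * cos c) - cos (n%:R * c).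
  rewrite mul2_cos_cos -[n.+2]addn1 -[n.+1]addn1 !natrD.
  by rewrite (_ : _ * c - c = n%:R * c); [rewrite [RHS]addrAC subrr add0r; congr cos; ring|ring].
by rewrite !step; ring.
Qed.

Lemma cos_chebB n k : (0 < k)%N -> (0 < n)%N ->
  cos (n.-1%:R * cheb_angle n k) = (-1) ^+ k.+1 * sin (cheb_angle n k) :> R.
Proof.
move=> k0 n0; have [c s] := @cos_sin_cheb R n k k0 n0.
rewrite -subn1 natrB// mulrBl mul1r cosB c s; ring.
Qed.

Lemma sum_cos_progression a m :
  2 * sin a * \sum_(1 <= j < m.+1) cos (2 * j%:R * a) =
  sin ((2 * m%:R + 1) * a) - sin a.
Proof.
elim: m => [|m IH]; first by rewrite big_geq// !mulr0 add0r mul1r; ring.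
rewrite big_nat_recr//= mulrDr IH.
rewrite (_ : (2 * m.+1%:R + 1) * a = 2 * m.+1%:R * a + a); last ring.
rewrite (_ : (2 * m%:R + 1) * a = 2 * m.+1%:R * a - a); last first.
  by rewrite -natr1; ring.
by rewrite sinB sinD; ring.
Qed.

(** Off the singularities this is Christoffel-Darboux at a node, where cos (n b) = 0 kills one
    product. At a singularity the terms become 1 + cos (2 j b), and the cosines cancel by
    [sum_cos_progression]. *)
Lemma lagrangePE n k t : (0 < k <= n)%N -> lagrangeP n k t =
  n%:R^-1 * (1 + \sum_(1 <= j < n) 2 * (cos (j%:R * cheb_angle n k) * cos (j%:R * t))).
Proof.
move=> kn; have /andP[k0 kn'] := kn.
have n0 : (0 < n)%N by exact: leq_trans kn'.
have n0' : n%:R != 0 :> R by rewrite pnatr_eq0 -lt0n.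
have [c s] := @cos_sin_cheb R n k k0 n0.
set b := cheb_angle n k in c s *.
rewrite /lagrangeP -/b; case: ifPn => [/eqP tb|tb]; last first.
  have := @christoffel_darboux t b n n0.
  rewrite c mulr0 subr0 cos_chebB// -/b => CD.
  have tb' : cos t - cos b != 0 by rewrite subr_eq0.
  apply: (mulfI tb'); rewrite [RHS]mulrCA CD /lagrange_quot -/b.
  by field; rewrite n0'.
have s0 : sin b != 0 by rewrite gt_eqF// sin_cheb_gt0.
under eq_big_nat => j _.
  rewrite (@cos_sin_natmul _ j _ _ tb).1 mul2_cos_cos subrr cos0.
  rewrite -mulr2n -mulrnAl -mulr_natl; over.
rewrite big_split/= sumr_const_nat subn1.
have := @sum_cos_progression b n.-1; rewrite prednK//.
rewrite (_ : (2 * n.-1%:R + 1) * b = n%:R * b + (n%:R * b - b)); last first.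
  by rewrite -subn1 natrB//; ring.
(* cos (n b) = 0 forces sin (2 n b) = 0 and cos (2 n b) = -1. *)
have -> : sin (n%:R * b + (n%:R * b - b)) = sin b.
  rewrite sinD sinB cosB c s; have : (-1) ^+ k.+1 * (-1) ^+ k.+1 = 1 :> R.
    by rewrite -expr2 sqrr_sign.
  by move=> e; ring: e.
move=> /eqP; rewrite subrr !mulf_eq0 (negbTE s0) pnatr_eq0/= => /eqP ->.
rewrite addr0 -{1}[n]prednK// -[X in X + _]/(1%:R) -natrD add1n prednK//.
by rewrite mulVf.
Qed.

(** The j-th coefficient of either side is 4 cos (j b) cos (j h) cos (j t), in which the node b and
    the shift h, itself the first node, can be exchanged. *)
Lemma lagrangeP_shift n k t : (0 < k <= n)%N ->
  lagrangeP n k (t + pi / (2 * n%:R)) + lagrangeP n k (t - pi / (2 * n%:R)) =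
  lagrangeP n 1 (t - cheb_angle n k) + lagrangeP n 1 (t + cheb_angle n k).
Proof.
move=> kn; have n1 : (0 < 1 <= n)%N by case/andP: kn => ? /(leq_trans _)->.
rewrite !lagrangePE// (cheb_angleE n 0) mulr0 add0r mul1r -!mulrDr.
set h := pi / _; set b := cheb_angle n k.
congr (_ * _); rewrite addrACA [RHS]addrACA; congr (_ + _).
rewrite -!big_split; apply: eq_bigr => j _ /=.
by rewrite !mulrBr ![j%:R * (_ + _)]mulrDr !cosB !cosD; ring.
Qed.

(** The nodes are odd multiples of h, so the factor 2 sin (j h) telescopes the sum to sin (j pi) =
    0; the range of j keeps that factor nonzero. *)
Lemma sum_cos_cheb n j : (0 < j < n)%N ->
  \sum_(1 <= k < n.+1) cos (j%:R * cheb_angle n k) = 0 :> R.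
Proof.
move=> /andP[j0 jn]; set h : R := pi / (2 * n%:R).
have n0 : 0 < n%:R :> R by rewrite ltr0n (leq_trans _ jn).
have j0' : 0 < j%:R :> R by rewrite ltr0n.
have jn' : j%:R < n%:R :> R by rewrite ltr_nat.
have hn : 2 * n%:R * h = pi by rewrite /h; field; rewrite gt_eqF.
have h0 : 0 < h by rewrite divr_gt0 ?pi_gt0// mulr_gt0.
have s0 : 0 < sin (j%:R * h).
  apply: sin_gt0_pi; rewrite mulr_gt0//= -hn.
  by rewrite ltr_pM2r//; lra.
have partial m : 2 * sin (j%:R * h) *
    \sum_(1 <= k < m.+1) cos (j%:R * cheb_angle n k) = sin (m%:R * (2 * j%:R * h)).
  elim: m => [|m IH]; first by rewrite big_geq// mulr0 mul0r sin0.
  rewrite big_nat_recr//= mulrDr IH cheb_angleE -/h.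
  rewrite (_ : m%:R * _ = j%:R * ((2 * m%:R + 1) * h) - j%:R * h); last ring.
  rewrite (_ : m.+1%:R * _ = j%:R * ((2 * m%:R + 1) * h) + j%:R * h); last first.
    by rewrite -natr1; ring.
  by rewrite sinB sinD; ring.
have := partial n; rewrite (_ : n%:R * _ = 0 + pi *+ j); last first.
  by rewrite -mulr_natr -hn; ring.
have -> : sin (0 + pi *+ j) = 0 :> R.
  elim: j {j0 jn j0' jn' s0 partial} => [|j IH]; first by rewrite addr0 sin0.
  by rewrite mulrSr addrA sinDpi IH oppr0.
by move/eqP; rewrite !mulf_eq0 pnatr_eq0 (gt_eqF s0)/= => /eqP.
Qed.

Lemma sum_lagrangeP n t : (0 < n)%N ->
  \sum_(1 <= k < n.+1) lagrangeP n k t = 1 :> R.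
Proof.
move=> n0; under eq_big_nat => k kn do rewrite lagrangePE//.
rewrite -mulr_sumr big_split/= sumr_const_nat subSS subn0 exchange_big_nat//=.
rewrite big_nat big1 ?addr0 ?mulVf ?pnatr_eq0 -?lt0n// => j /sum_cos_cheb sj.
by rewrite -mulr_sumr -mulr_suml sj mul0r mulr0.
Qed.

(** Crude bound for cells at distance at most 1, where the decay estimate says nothing. *)
Lemma lagrangeP_le2 n t : (0 < n)%N -> `|lagrangeP n 1 t| <= 2 :> R.
Proof.
move=> n0; have n0' : 0 < n%:R :> R by rewrite ltr0n.
rewrite lagrangePE ?n0// normrM normfV (gtr0_norm n0') ler_pdivrMl//.
apply: (@le_trans _ _ (1 + \sum_(1 <= j < n) 2)); last first.
  by rewrite sumr_const_nat -[X in _ + X]mulr_natr natrB// mulrBr; lra.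
rewrite (le_trans (ler_normD _ _))// normr1 lerD2l.
rewrite (le_trans (ler_norm_sum _ _ _))// ler_sum// => j _.
by rewrite normrM ger0_norm// ler_piMr// normrM mulr_ile1 ?cos_max.
Qed.

(** [y] is separate from [t] because both arguments, t - theta_k and t + theta_k, will be compared
    with the single distance |t - theta_k|. The strict hypothesis excludes the removable
    singularity. *)
Lemma lagrangeP_decay n t y : (0 < n)%N ->
  cos t <= cos y -> cos y < cos (pi / (2 * n%:R)) ->
  `|lagrangeP n 1 t| <=
    pi / (2 * n%:R) / (n%:R * (cos (pi / (2 * n%:R)) - cos y)) :> R.
Proof.
move=> n0 ty; set h := pi / _ => yh; have n0' : 0 < n%:R :> R by rewrite ltr0n.
have h0 : 0 <= h by rewrite divr_ge0 ?pi_ge0// mulr_ge0 ?ltW.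
have hpi : h <= pi.
  rewrite ler_pdivrMr ?mulr_gt0// ler_peMr ?pi_ge0//.
  by have : 1 <= n%:R :> R; [rewrite ler1n|lra].
have bE : cheb_angle n 1 = h by rewrite cheb_angleE mulr0 add0r mul1r.
rewrite /lagrangeP bE; case: ifPn => [/eqP th|th]; first by move: ty; rewrite leNgt th yh.
rewrite /lagrange_quot bE expr2 mulrNN !mul1r normrM normfV !normrM.
rewrite (gtr0_norm n0') distrC (@gtr0_norm _ (_ - _)); last lra.
have s0 : 0 <= sin h by rewrite sin_ge0_pi// h0.
apply: ler_pM; rewrite ?invr_ge0 ?mulr_ge0//; first lra.
  rewrite (ger0_norm s0) (le_trans _ (@le_sin _ h0))//.
  by rewrite ler_piMl// cos_max.
rewrite lef_pV2 ?posrE ?mulr_gt0//; [|lra|lra].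
by rewrite ler_pM2l//; lra.
Qed.

(** In the product formula both sines are at least (y - h) / 8. For (y + h) / 2, which may exceed pi
    / 2, this goes through comparison with the other sine. *)
Lemma cosB_ge h y : 0 <= h -> h <= y -> y <= pi ->
  (y - h) ^+ 2 / 32 <= cos h - cos y.
Proof.
move=> h0 hy ypi; have p2 := @pi_gt0 R.
have -> : cos h - cos y = 2 * (sin ((y + h) / 2) * sin ((y - h) / 2)).
  rewrite (_ : cos h = cos ((y + h) / 2 - (y - h) / 2)); last by congr cos; field.
  rewrite (_ : cos y = cos ((y + h) / 2 + (y - h) / 2)); last by congr cos; field.
  by rewrite cosB cosD; ring.
have s1 : (y - h) / 8 <= sin ((y - h) / 2).
  rewrite (_ : (y - h) / 8 = (y - h) / 2 / 4); last by field.
  by apply: sin_ge; apply/andP; split; lra.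
have s2 : sin ((y - h) / 2) <= sin ((y + h) / 2).
  rewrite (_ : (y - h) / 2 = y / 2 - h / 2); last by field.
  rewrite (_ : (y + h) / 2 = y / 2 + h / 2); last by field.
  rewrite sinB sinD.
  have c0 : 0 <= cos (y / 2) by apply: cos_ge0_pihalf; apply/andP; split; lra.
  have s0 : 0 <= sin (h / 2) by apply: sin_ge0_pi; apply/andP; split; lra.
  by have := mulr_ge0 c0 s0; lra.
by nra.
Qed.

(* The product (d + 1)(d + 2), of the size of the decay (d - 1)^-2, makes the weights
   telescope; 192 = 16 * 12 absorbs the ratio at d = 2. *)
Definition cell_weight (d : nat) : R := 192 / ((d%:R + 1) * (d%:R + 2)).

(* One of the two truncated differences is always zero. *)
Definition natdist i j : nat := (i - j) + (j - i).

Lemma cell_weight_ge0 d : 0 <= cell_weight d.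
Proof. by rewrite divr_ge0// mulr_ge0// addr_ge0. Qed.

Lemma GK_kernel_le n i j t : (i < n)%N -> (j < n)%N ->
  i%:R * (pi / n%:R) <= t <= i.+1%:R * (pi / n%:R) ->
  `|lagrangeP n j.+1 (t + pi / (2 * n%:R)) +
    lagrangeP n j.+1 (t - pi / (2 * n%:R))| <= cell_weight (natdist i j).
Proof.
move=> i_n j_n; set m := natdist i j; set h := pi / (2 * n%:R).
have n0 : (0 < n)%N by exact: leq_trans i_n.
have n0' : 0 < n%:R :> R by rewrite ltr0n.
have h0 : 0 < h by rewrite divr_gt0 ?pi_gt0// mulr_gt0.
have nh : 2 * n%:R * h = pi by rewrite /h; field; rewrite gt_eqF.
rewrite (_ : pi / n%:R = 2 * h); last by rewrite /h; field; rewrite gt_eqF.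
rewrite lagrangeP_shift// -[i.+1%:R]natr1 => /andP[t1 t2].
have [m2|m2] := leqP m 1.
  apply: (@le_trans _ _ 4).
    by rewrite (le_trans (ler_normD _ _))// (_ : 4 = 2 + 2 :> R) ?lerD ?lagrangeP_le2//; lra.
  have M : m%:R <= 1 :> R by rewrite lern1.
  have M0 : 0 <= m%:R :> R by [].
  rewrite /cell_weight ler_pdivlMr; last by rewrite mulr_gt0//; lra.
  nra.
set b := cheb_angle n j.+1; have bE : b = (2 * j%:R + 1) * h by rewrite /b cheb_angleE.
set y : R := `|t - b|.
have M2 : 2 <= m%:R :> R by rewrite ler_nat.
have iN : i%:R + 1 <= n%:R :> R by rewrite natr1 ler_nat.
have jN : j%:R + 1 <= n%:R :> R by rewrite natr1 ler_nat.
have t0 : 0 <= t by apply: le_trans t1; rewrite mulr_ge0// mulr_ge0// ltW.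
have tpi : t <= pi by apply: (le_trans t2); rewrite -nh; nra.
have j0 : 0 <= j%:R :> R by [].
have b0 : 0 <= b by rewrite bE; nra.
have bpi : b <= pi by rewrite bE -nh; nra.
(* Cells have width 2 h and b is the midpoint of cell [j], which costs one h against the distance 2
   m h of the left endpoints. *)
have y1 : (2 * m%:R - 1) * h <= y.
  have [ij|ji] := leqP i j.
    have mE : m%:R = j%:R - i%:R :> R by rewrite /m /natdist (eqP ij) add0n natrB.
    by rewrite /y distrC (le_trans _ (ler_norm _))// bE mE; nra.
  have mE : m%:R = i%:R - j%:R :> R.
    by rewrite /m /natdist (eqP (ltnW ji)) addn0 natrB// ltnW.
  by rewrite /y (le_trans _ (ler_norm _))// bE mE; nra.
have ypi : y <= pi by rewrite /y ler_norml; apply/andP; split; lra.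
have hy : h <= y by apply: le_trans y1; nra.
have dec := @cosB_ge h y (ltW h0) hy ypi.
have gap : (2 * (m%:R - 1) * h) ^+ 2 <= (y - h) ^+ 2.
  by rewrite ler_sqr ?nnegrE; nra.
have gap0 : 0 < (2 * (m%:R - 1) * h) ^+ 2 by rewrite exprn_gt0// mulr_gt0//; lra.
have cyb : cos y = cos (t - b) by rewrite /y cos_norm.
(* As t and b lie in [0, pi], the reflected argument t + b is no worse than t - b. *)
have cyb' : cos (t + b) <= cos y.
  have st : 0 <= sin t by rewrite sin_ge0_pi// t0.
  have sb : 0 <= sin b by rewrite sin_ge0_pi// b0.
  by rewrite cyb cosB cosD; have := mulr_ge0 st sb; lra.
have yh : cos y < cos h by lra.
apply: (@le_trans _ _ (h / (n%:R * (cos h - cos y)) + h / (n%:R * (cos h - cos y)))).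
  by rewrite (le_trans (ler_normD _ _))// lerD ?lagrangeP_decay// cyb.
rewrite -mulrDl ler_pdivrMr; last by rewrite mulr_gt0//; lra.
have pi2 := @pi_ge2 R.
apply: (@le_trans _ _ (cell_weight m * (n%:R * ((2 * (m%:R - 1) * h) ^+ 2 / 32)))); last first.
  by rewrite ler_wpM2l ?cell_weight_ge0// ler_pM2l//; lra.
rewrite /cell_weight mulrAC ler_pdivlMr; last by rewrite mulr_gt0//; lra.
rewrite [leRHS](_ : _ = 12 * (m%:R - 1) ^+ 2 * (2 * n%:R * h) * h); last by field.
rewrite nh.
(* Equality holds at m = 2. *)
have le12 : (m%:R + 1) * (m%:R + 2) <= 12 * (m%:R - 1) ^+ 2 :> R by nra.
rewrite (_ : (h + h) * _ = (m%:R + 1) * (m%:R + 2) * 2 * h); last by ring.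
by rewrite ler_pM2r// ler_pM// mulr_ge0// addr_ge0.
Qed.

End trigonometry.

(** * Discrete Schur test *)

Section schur.
Context {R : realType}.
Implicit Types (p x m C : R) (f b F : nat -> R) (i j d n : nat).

(** The graph of x^p lies above its tangent at m. Being linear in x, this form can be summed or
    integrated with m fixed, which yields Jensen's inequality. The case p = 1 has no finite
    conjugate exponent and is treated apart. *)
Lemma powR_young p x m : 1 <= p -> 0 <= x -> 0 <= m ->
  p * m `^ (p - 1) * x <= x `^ p + (p - 1) * m `^ p.
Proof.
move=> p1 x0 m0; have [->|pn1] := eqVneq p 1.
  by rewrite subrr powRr0 powRr1// !mul1r mul0r addr0.
have p1' : 0 < p - 1 by rewrite subr_gt0 lt_neqAle eq_sym pn1.
have p0 : 0 < p by lra.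
have q0 : 0 < p / (p - 1) by rewrite divr_gt0.
have := @conjugate_powR _ x (m `^ (p - 1)) p (p / (p - 1)) x0 (powR_ge0 _ _) p0 q0.
rewrite -powRrM mulrCA divff ?gt_eqF// mulr1 => /(_ _) H.
have {}H : x * m `^ (p - 1) <= x `^ p / p + m `^ p / (p / (p - 1)).
  by apply: H; field; rewrite !gt_eqF.
rewrite -(ler_pM2l p0) in H; apply: le_trans (le_trans H _).
  by rewrite [X in X <= _](_ : _ = p * (x * m `^ (p - 1)))//; ring.
by rewrite le_eqVlt; apply/orP; left; apply/eqP; field; rewrite !gt_eqF.
Qed.

Lemma natdistC i j : natdist i j = natdist j i.
Proof. by rewrite /natdist addnC. Qed.

Lemma le_sum_nat_prefix f k n : (k <= n)%N -> (forall d, 0 <= f d) ->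
  \sum_(0 <= d < k) f d <= \sum_(0 <= d < n) f d.
Proof.
move=> kn f0; rewrite (big_cat_nat (leq0n _) kn)//= lerDl.
by apply: sumr_ge0.
Qed.

(** Each distance occurs at most once on either side of [i]. *)
Lemma sum_natdist_le f n i : (forall d, 0 <= f d) -> (i < n)%N ->
  \sum_(0 <= j < n) f (natdist i j) <= 2 * \sum_(0 <= d < n) f d.
Proof.
move=> f0 i_n; rewrite (big_cat_nat (leq0n _) (ltnW i_n))//= mulr_natl mulr2n; apply: lerD.
  apply: (@le_trans _ _ (\sum_(0 <= d < i.+1) f d)); last exact: le_sum_nat_prefix.
  rewrite big_nat_recl// big_nat_rev/= add0n.
  rewrite (eq_big_nat _ _ (F2 := fun d => f d.+1)); first by rewrite lerDr.
  by move=> j /andP[_ ji]; congr f; rewrite /natdist; lia.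
rewrite -{1}[i]add0n big_addn.
rewrite (eq_big_nat _ _ (F2 := f)) ?le_sum_nat_prefix ?leq_subr//.
by move=> j _; congr f; rewrite /natdist; lia.
Qed.

Lemma sum_cell_weight n i : (i < n)%N ->
  \sum_(0 <= j < n) @cell_weight R (natdist i j) <= 384.
Proof.
move=> i_n; apply: le_trans (@sum_natdist_le _ n i (@cell_weight_ge0 R) i_n) _.
have -> : \sum_(0 <= d < n) @cell_weight R d = 192 * (1 - (n%:R + 1)^-1).
  elim: n {i i_n} => [|n IH]; first by rewrite big_geq// add0r invr1 subrr mulr0.
  rewrite big_nat_recr//= IH /cell_weight -natr1; have n0 : 0 <= n%:R :> R by [].
  by field; rewrite !gt_eqF//; lra.
have : 0 <= (n%:R + 1)^-1 :> R by rewrite invr_ge0 addr_ge0.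
by lra.
Qed.

(** The moment is a harmonic sum. A square root bounds it by a simple induction and is still o(n),
    which suffices in [GK_approx]. *)
Lemma sum_cell_weight_moment n i : (i < n)%N ->
  \sum_(0 <= j < n) ((natdist i j)%:R + 1) * @cell_weight R (natdist i j)
    <= 768 * Num.sqrt n%:R.
Proof.
move=> i_n.
have f0 d : 0 <= (d%:R + 1) * @cell_weight R d.
  by rewrite mulr_ge0 ?cell_weight_ge0// addr_ge0.
apply: le_trans (@sum_natdist_le _ n i f0 i_n) _.
suff : \sum_(0 <= d < n) (d%:R + 1) * @cell_weight R d <= 384 * Num.sqrt n%:R by lra.
elim: n {i i_n} => [|n IH]; first by rewrite big_geq// sqrtr0 mulr0.
rewrite big_nat_recr//=; set a := Num.sqrt n%:R in IH; set b := Num.sqrt n.+1%:R.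
have a0 : 0 <= a by exact: sqrtr_ge0.
have b0 : 0 <= b by exact: sqrtr_ge0.
have a2 : a ^+ 2 = n%:R by rewrite sqr_sqrtr.
have b2 : b ^+ 2 = n%:R + 1 by rewrite sqr_sqrtr// natr1.
have -> : (n%:R + 1) * cell_weight n = 192 / (n%:R + 2) :> R.
  by rewrite /cell_weight; have n0 : 0 <= n%:R :> R by []; field; rewrite !gt_eqF//; lra.
(* b - a = 1 / (a + b) >= 1 / (2 b), and 2 b <= b^2 + 1 = n + 2. *)
suff : 192 / (n%:R + 2) <= 384 * (b - a) by lra.
rewrite ler_pdivrMr; last by rewrite -a2; nra.
have ab : a <= b by nra.
have : 1 <= (b - a) * (2 * b) by nra.
have : 0 <= b - a by lra.
have : 2 * b <= n%:R + 2 by rewrite -a2; nra.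
nra.
Qed.

(** The last hypothesis is b_j^p <= F_j in tangent form (take x = b_j), as [mean_powR_le] supplies
    it for cell integrals. Row sums serve Jensen's inequality, column sums the final summation over
    i. *)
Lemma schur_test (n : nat) (w : nat -> nat -> R) p C b F : 1 <= p -> 0 < C ->
  (forall i j, 0 <= w i j) -> (forall j, 0 <= b j) -> (forall j, 0 <= F j) ->
  (forall i, (i < n)%N -> \sum_(0 <= j < n) w i j <= C) ->
  (forall j, (j < n)%N -> \sum_(0 <= i < n) w i j <= C) ->
  (forall j x, (j < n)%N -> 0 <= x -> p * x `^ (p - 1) * b j <= F j + (p - 1) * x `^ p) ->
  \sum_(0 <= i < n) (\sum_(0 <= j < n) w i j * b j) `^ p <=
  C `^ p * \sum_(0 <= j < n) F j.
Proof.
move=> p1 C0 w0 b0 F0 row col bF.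
pose B i := \sum_(0 <= j < n) w i j * b j.
pose x i := B i / C.
have x0 i : 0 <= x i.
  by rewrite divr_ge0 ?(ltW C0)// sumr_ge0// => j _; rewrite mulr_ge0.
(* Young's inequality at x_i = B_i / C, summed against the weights, is Jensen's inequality. *)
have main i : (i < n)%N -> C * x i `^ p <= \sum_(0 <= j < n) w i j * F j.
  move=> i_n; have H : p * x i `^ (p - 1) * B i <=
      \sum_(0 <= j < n) w i j * F j + (p - 1) * x i `^ p * C.
    apply: (@le_trans _ _ (\sum_(0 <= j < n) w i j * (F j + (p - 1) * x i `^ p))).
      rewrite mulr_sumr; apply: ler_sum_nat => j /andP[_ jn].
      by rewrite mulrCA ler_wpM2l ?bF.
    under eq_bigr do rewrite mulrDr.
    rewrite big_split/= lerD2l -mulr_suml mulrC ler_wpM2l ?row//.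
    by rewrite mulr_ge0 ?powR_ge0 ?subr_ge0.
  have BE : B i = C * x i by rewrite /x mulrC divfK// gt_eqF.
  have xp : x i * x i `^ (p - 1) = x i `^ p by rewrite mulr_powRB1//; lra.
  move: H; rewrite BE (_ : _ * (C * x i) = p * C * (x i * x i `^ (p - 1))); last ring.
  by rewrite xp; lra.
apply: (@le_trans _ _ (C `^ p * \sum_(0 <= i < n) x i `^ p)).
  rewrite mulr_sumr; apply: ler_sum => i _.
  by rewrite -powRM ?(ltW C0)// /x mulrC divfK// gt_eqF.
rewrite ler_wpM2l ?powR_ge0// -(ler_pM2l C0) mulr_sumr.
apply: (@le_trans _ _ (\sum_(0 <= i < n) \sum_(0 <= j < n) w i j * F j)).
  by apply: ler_sum_nat => i /andP[_]; exact: main.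
rewrite exchange_big_nat//= mulr_sumr; apply: ler_sum_nat => j /andP[_ jn].
by rewrite -mulr_suml ler_wpM2r ?col.
Qed.

End schur.

(** * Bounds for the operators *)

Section operator.
Context {R : realType}.
Notation mu := (@lebesgue_measure R).
Notation D := (`[0, pi]%classic : set R).
Implicit Types (p K e s t x y : R) (f g u : R -> R) (i j n : nat).

(** The right half of the [j]-th of the [n] equal cells of [0, pi], counted from 0: the node is the
    midpoint of that cell. *)
Definition cheb_cell n j : set R :=
  `[cheb_angle n j.+1, cheb_angle n j.+1 + pi / (2 * n%:R)].

Lemma GKE n f t : GK n f t = \sum_(0 <= j < n)
  (n%:R / pi * \int[mu]_(x in cheb_cell n j) f x) *
  (lagrangeP n j.+1 (t + pi / (2 * n%:R)) + lagrangeP n j.+1 (t - pi / (2 * n%:R))).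
Proof.
rewrite /GK mulr_sumr big_add1/=.
by apply: eq_bigr => j _; rewrite mulrA.
Qed.

Lemma cheb_cell_measurable n j : measurable (cheb_cell n j : set (measurableTypeR R)).
Proof. exact: measurable_itv. Qed.

Lemma cheb_cell_measure n j : (0 < n)%N -> mu (cheb_cell n j) = (pi / (2 * n%:R))%:E.
Proof.
move=> n0; have h0 : 0 < pi / (2 * n%:R) :> R.
  by rewrite divr_gt0 ?pi_gt0// mulr_gt0// ltr0n.
rewrite /cheb_cell lebesgue_measure_itv/= lte_fin ltrDl h0.
by rewrite -EFinB addrAC subrr add0r.
Qed.

Lemma cheb_cell_bounds n j t : (0 < n)%N -> cheb_cell n j t ->
  j%:R * (pi / n%:R) < t <= j.+1%:R * (pi / n%:R).
Proof.
move=> n0; have n0' : 0 < n%:R :> R by rewrite ltr0n.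
have h0 : 0 < pi / (2 * n%:R) :> R by rewrite divr_gt0 ?pi_gt0// mulr_gt0.
rewrite /cheb_cell /= in_itv/= cheb_angleE -[j.+1%:R]natr1.
rewrite (_ : pi / n%:R = 2 * (pi / (2 * n%:R))); last by field; rewrite gt_eqF.
by move=> /andP[? ?]; apply/andP; split; lra.
Qed.

Lemma cheb_cell_sub n j : (j < n)%N -> cheb_cell n j `<=` D.
Proof.
move=> jn t /(@cheb_cell_bounds _ _ _ (leq_trans (ltn0Sn j) jn))/andP[t0 tpi].
have n0 : 0 < n%:R :> R by rewrite ltr0n (leq_trans _ jn).
have c0 : 0 <= pi / n%:R :> R by rewrite divr_ge0 ?pi_ge0// ltW.
rewrite /= in_itv/=; apply/andP; split.
  by rewrite (le_trans _ (ltW t0))// mulr_ge0.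
rewrite (le_trans tpi)// mulrCA ler_piMr ?pi_ge0// ler_pdivrMr// mul1r.
by rewrite ler_nat.
Qed.

(** These closed intervals do not even share endpoints, since each starts at the midpoint of its
    cell: the left inequality of [cheb_cell_bounds] is strict. *)
Lemma cheb_cell_trivIset n : (0 < n)%N -> trivIset setT (cheb_cell n).
Proof.
move=> n0; have c0 : 0 < pi / n%:R :> R by rewrite divr_gt0 ?pi_gt0// ltr0n.
have main i j t : (i < j)%N -> cheb_cell n i t -> cheb_cell n j t -> False.
  move=> ij /(@cheb_cell_bounds _ _ _ n0)/andP[_ ti].
  move=> /(@cheb_cell_bounds _ _ _ n0)/andP[tj _].
  have := lt_le_trans tj ti; rewrite ltr_pM2r// ltr_nat ltnS.
  by rewrite leqNgt ij.
move=> i j _ _ [t [ti tj]]; have [ij|ji|//] := ltngtP i j.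
  by case: (main _ _ _ ij ti tj).
by case: (main _ _ _ ji tj ti).
Qed.

Lemma cell_exists n t : (0 < n)%N -> D t ->
  exists2 i, (i < n)%N & i%:R * (pi / n%:R) <= t <= i.+1%:R * (pi / n%:R).
Proof.
rewrite /= in_itv/= => n0 /andP[t0].
have n0' : n%:R != 0 :> R by rewrite pnatr_eq0 -lt0n.
rewrite -[X in t <= X -> _](_ : n%:R * (pi / n%:R) = pi); last by field.
(* The width must stay fixed while the number of cells varies. *)
move: (pi / n%:R) => c {n0'}; elim: n n0 => // n IH _ tc.
have [tn|tn] := leP t (n%:R * c); last first.
  by exists n => //; rewrite tc ltW.
case: n => [|n] in IH tc tn *; first by exists 0%N => //; rewrite mul0r t0 tc.
by have [i i_n ti] := IH isT tn; exists i => //; exact: leqW.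
Qed.

Lemma continuous_GK n f : continuous (GK n f).
Proof.
rewrite (funext (GKE n f)) => t; rewrite /continuous_at.
under eq_fun do rewrite big_mkord; rewrite big_mkord.
apply: cvg_big => [|m _]; first exact: add_continuous.
apply: cvgM; first exact: cvg_cst.
have cP := @lagrangeP_continuous R n m.+1 (ltn_ord m).
have shift (a : R) : lagrangeP n m.+1 (x + a) @[x --> t] --> lagrangeP n m.+1 (t + a).
  apply: (@continuous_comp _ _ _ (fun x : R => x + a) (lagrangeP n m.+1) t); last exact: cP.
  by apply: cvgD; [exact: cvg_id|exact: cvg_cst].
by apply: cvgD; exact: shift.
Qed.

Lemma measurable_GK n f : measurable_fun (setT : set (measurableTypeR R)) (GK n f).
Proof. by apply: continuous_measurable_fun; exact: continuous_GK. Qed.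

Lemma GK_le n f i t : (i < n)%N -> i%:R * (pi / n%:R) <= t <= i.+1%:R * (pi / n%:R) ->
  (forall j, (j < n)%N -> mu.-integrable (cheb_cell n j) (EFin \o f)) ->
  `|GK n f t| <= \sum_(0 <= j < n) cell_weight (natdist i j) *
    (n%:R / pi * \int[mu]_(x in cheb_cell n j) `|f x|).
Proof.
move=> i_n ti intf; rewrite GKE (le_trans (ler_norm_sum _ _ _))// ler_sum_nat// => j /=.
move=> jn; rewrite normrM mulrC ler_pM// ?GK_kernel_le//.
rewrite normrM ger0_norm; last by rewrite divr_ge0 ?pi_ge0.
rewrite ler_wpM2l ?divr_ge0 ?pi_ge0// le_normr_Rintegral ?intf//.
exact: cheb_cell_measurable.
Qed.

Lemma cell_integrable n j f : (j < n)%N ->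
  mu.-integrable D (EFin \o f) -> mu.-integrable (cheb_cell n j) (EFin \o f).
Proof.
move=> jn; apply: integrableS; [exact: measurable_itv|exact: cheb_cell_measurable|].
exact: cheb_cell_sub.
Qed.

Lemma sum_cell_integral_le n f : (0 < n)%N -> (forall x, 0 <= f x) ->
  mu.-integrable D (EFin \o f) ->
  \sum_(0 <= j < n) \int[mu]_(x in cheb_cell n j) f x <= \int[mu]_(x in D) f x.
Proof.
move=> n0 f0 intf; rewrite -lee_fin -sumEFin [leRHS]fineK; last first.
  by apply: integrable_fin_num => //; exact: measurable_itv.
rewrite (eq_big_nat _ _ (F2 := fun j => \int[mu]_(x in cheb_cell n j) (f x)%:E)%E); last first.
  move=> j /andP[_ jn]; rewrite fineK//; apply: integrable_fin_num => //.
    exact: cheb_cell_measurable.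
  exact: cell_integrable.
have mcell j : measurable (cheb_cell n j) by exact: cheb_cell_measurable.
have sub : \big[setU/set0]_(0 <= j < n) cheb_cell n j `<=` D.
  by rewrite big_mkord -bigcup_mkord => x [j /= jn]; exact: cheb_cell_sub.
have mf := measurable_int mu intf.
have mU : measurable (\big[setU/set0]_(0 <= j < n) cheb_cell n j).
  by apply: bigsetU_measurable => j _; exact: mcell.
rewrite -(@ge0_integral_bigsetU _ _ _ mu _ (cheb_cell n)) ?iota_uniq//.
- apply: ge0_subset_integral => //.
  by move=> x _; rewrite lee_fin.
- by apply: (@sub_trivIset _ _ _ setT); [exact: subsetT|exact: cheb_cell_trivIset].
- exact: measurable_funS mf.
- by move=> x _; rewrite lee_fin.
Qed.

Lemma cheb_cell_integrable_cst n j (c : R) :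
  mu.-integrable (cheb_cell n j) (EFin \o cst c).
Proof.
apply: continuous_compact_integrable; first exact: segment_compact.
by apply: continuous_subspaceT => x; exact: cvg_cst.
Qed.

Lemma Rintegral_cheb_cell_cst n j (c : R) : (0 < n)%N ->
  \int[mu]_(x in cheb_cell n j) c = c * (pi / (2 * n%:R)).
Proof.
move=> n0; rewrite Rintegral_cst; last exact: cheb_cell_measurable.
by congr (_ * _); rewrite -[RHS]/(fine _%:E) -(@cheb_cell_measure n j).
Qed.

End operator.

(** * Norm bound and uniform estimate for the operators *)

Section convergence.
Context {R : realType}.
Notation mu := (@lebesgue_measure R).
Notation D := (`[0, pi]%classic : set R).
Implicit Types (p K e s t x y : R) (f g u : R -> R) (i j n : nat).

Lemma measurable_norm_powR (A : set (measurableTypeR R)) p u :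
  measurable_fun A u -> measurable_fun A (fun t => `|u t| `^ p).
Proof.
move=> mu; apply: (measurableT_comp (measurable_powR p)).
exact: measurableT_comp.
Qed.

(** [powR_young] integrated over the half cell, in the shape that [schur_test] requires. *)
Lemma mean_powR_le n j p x u : (j < n)%N -> 1 <= p -> 0 <= x ->
  mu.-integrable D (EFin \o u) ->
  mu.-integrable D (EFin \o (fun t => `|u t| `^ p)) ->
  p * x `^ (p - 1) * (n%:R / pi * \int[mu]_(t in cheb_cell n j) `|u t|) <=
  n%:R / pi * (\int[mu]_(t in cheb_cell n j) `|u t| `^ p) + (p - 1) * x `^ p.
Proof.
move=> jn p1 x0 iu iup; have n0 : (0 < n)%N by exact: leq_trans jn.
have n0' : 0 < n%:R :> R by rewrite ltr0n.
have mI := @cheb_cell_measurable R n j.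
have iu' : mu.-integrable (cheb_cell n j) (EFin \o (fun t => `|u t|)).
  by apply: integrable_norm; exact: cell_integrable.
have iup' : mu.-integrable (cheb_cell n j) (EFin \o (fun t => `|u t| `^ p)).
  exact: (cell_integrable _ _ (fun t => `|u t| `^ p)).
have ic : mu.-integrable (cheb_cell n j) (EFin \o cst ((p - 1) * x `^ p)).
  exact: cheb_cell_integrable_cst.
have H : p * x `^ (p - 1) * (\int[mu]_(t in cheb_cell n j) `|u t|) <=
    (\int[mu]_(t in cheb_cell n j) `|u t| `^ p) + (p - 1) * x `^ p * (pi / (2 * n%:R)).
  rewrite -RintegralZl//.
  have <- : \int[mu]_(t in cheb_cell n j) ((p - 1) * x `^ p) =
      (p - 1) * x `^ p * (pi / (2 * n%:R)).
    by rewrite Rintegral_cheb_cell_cst.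
  rewrite -RintegralD//; apply: le_Rintegral => //.
  - exact: (integrableZl mI (p * x `^ (p - 1)) iu').
  - exact: (integrableD mI iup' ic).
  - by move=> t _; exact: powR_young.
rewrite mulrCA; have c0 : 0 < n%:R / pi :> R by rewrite divr_gt0 ?pi_gt0.
move: H; rewrite -(ler_pM2l c0) => /le_trans; apply.
(* The half cell has measure pi / (2n), so only half of the allowed constant term appears. *)
rewrite mulrDr lerD2l (_ : n%:R / pi * _ = (p - 1) * x `^ p / 2); last first.
  by have := @pi_gt0 R; move: (@pi R) => a a0; field; rewrite !gt_eqF.
have : 0 <= (p - 1) * x `^ p by rewrite mulr_ge0 ?powR_ge0 ?subr_ge0.
lra.
Qed.

Lemma GK_powR_integral_le n p u : (0 < n)%N -> 1 <= p ->
  mu.-integrable D (EFin \o u) ->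
  mu.-integrable D (EFin \o (fun t => `|u t| `^ p)) ->
  (\int[mu]_(t in D) (`|GK n u t| `^ p)%:E <=
   (384 `^ p * \int[mu]_(t in D) `|u t| `^ p)%:E)%E.
Proof.
move=> n0 p1 iu iup; have n0' : 0 < n%:R :> R by rewrite ltr0n.
have c0 : 0 < n%:R / pi :> R by rewrite divr_gt0 ?pi_gt0.
pose b j := n%:R / pi * \int[mu]_(t in cheb_cell n j) `|u t|.
pose F j := n%:R / pi * \int[mu]_(t in cheb_cell n j) `|u t| `^ p.
pose B i := \sum_(0 <= j < n) @cell_weight R (natdist i j) * b j.
pose J i : set (measurableTypeR R) := `[i%:R * (pi / n%:R), i.+1%:R * (pi / n%:R)]%classic.
have mJ i : measurable (J i) by exact: measurable_itv.
have mD : measurable (D : set (measurableTypeR R)) by exact: measurable_itv.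
have b0 j : 0 <= b j.
  by rewrite mulr_ge0 ?(ltW c0)//; apply: Rintegral_ge0.
have F0 j : 0 <= F j.
  by rewrite mulr_ge0 ?(ltW c0)//; apply: Rintegral_ge0 => t _; exact: powR_ge0.
have Bp0 i : 0 <= B i `^ p by exact: powR_ge0.
have ind0 i t : (0 <= (\1_(J i) t)%:E :> \bar R)%E by rewrite lee_fin.
have mind i : measurable_fun (D : set (measurableTypeR R)) (fun t => (\1_(J i) t)%:E : \bar R).
  by apply/measurable_EFinP; exact: measurable_indic.
pose G i t : \bar R := ((B i `^ p)%:E * (\1_(J i) t)%:E)%E.
have G0 i t : (0 <= G i t)%E by rewrite mule_ge0 ?lee_fin.
have mG i : measurable_fun (D : set (measurableTypeR R)) (G i) by exact: measurable_funeM.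
(* |GK_n u|^p lies below a step function with value B_i^p on cell i. The closed cells [J i] overlap
   at endpoints, which only raises this nonnegative majorant. *)
apply: (@le_trans _ _ (\int[mu]_(t in D) \sum_(0 <= i < n) G i t)%E).
  apply: ge0_le_integral => //.
  - apply/measurable_EFinP; apply: measurable_norm_powR.
    by apply: measurable_funTS; exact: measurable_GK.
  - exact: emeasurable_sum.
  - move=> t Dt; have [i i_n ti] := @cell_exists R n t n0 Dt.
    rewrite big_mkord (bigD1 (Ordinal i_n))//= {1}/G indicE mem_set; last by rewrite /J/= in_itv.
    rewrite mule1 -[leLHS]adde0 leeD//; last by apply: sume_ge0.
    rewrite lee_fin ge0_ler_powR ?nnegrE//; first by lra.
      by rewrite sumr_ge0// => j _; rewrite mulr_ge0 ?cell_weight_ge0.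
    by apply: GK_le => // j jn; exact: cell_integrable.
rewrite ge0_integral_sum//.
apply: (@le_trans _ _ (\sum_(0 <= i < n) (B i `^ p * (pi / n%:R))%:E)%E).
  apply: lee_sum => i _; rewrite ge0_integralZl_EFin//.
  rewrite EFinM lee_wpmul2l ?lee_fin// integral_indic//.
  apply: (@le_trans _ _ (mu (J i))).
    by apply: le_measure; rewrite ?inE//; exact: measurableI.
  rewrite /J lebesgue_measure_itv/= lte_fin; case: ifPn => _; last first.
    by rewrite lee_fin divr_ge0 ?pi_ge0.
  by rewrite -EFinB lee_fin -natr1; lra.
rewrite sumEFin lee_fin -mulr_suml -ler_pdivlMr; last by rewrite divr_gt0 ?pi_gt0.
have schur := @schur_test R n (fun i j => cell_weight (natdist i j)) p 384 b F p1.
apply: le_trans (schur _ _ b0 F0 _ _ _) _ => //.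
- by move=> i j; exact: cell_weight_ge0.
- exact: sum_cell_weight.
- by move=> j jn; under eq_bigr do rewrite natdistC; exact: sum_cell_weight.
- by move=> j x jn x0; exact: mean_powR_le.
(* The factor n / pi in [F] matches the inverse of the cell length pi / n. *)
rewrite invf_div -mulrA ler_wpM2l ?powR_ge0// -mulr_sumr mulrC ler_wpM2r ?(ltW c0)//.
by apply: sum_cell_integral_le => // t; exact: powR_ge0.
Qed.

(** 192 and 384 are half the bounds on the sum and the first moment of the weights, the half being
    the mass of a half cell; sqrt n / n leaves 1 / sqrt n. *)
Lemma GK_approx n g e K t : (0 < n)%N -> 0 <= e -> 0 <= K -> D t ->
  mu.-integrable D (EFin \o g) ->
  (forall x y, D x -> D y -> `|g x - g y| <= e + K * `|x - y|) ->
  `|GK n g t - g t| <= 192 * e + 384 * K * pi / Num.sqrt n%:R.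
Proof.
move=> n0 e0 K0 Dt ig modg; have n0' : 0 < n%:R :> R by rewrite ltr0n.
have c0 : 0 < n%:R / pi :> R by rewrite divr_gt0 ?pi_gt0.
have [i i_n ti] := @cell_exists R n t n0 Dt.
pose Q j := lagrangeP n j.+1 (t + pi / (2 * n%:R)) + lagrangeP n j.+1 (t - pi / (2 * n%:R)).
have sumQ : \sum_(0 <= j < n) Q j = 2.
  have := @sum_lagrangeP R n (t + pi / (2 * n%:R)) n0.
  have := @sum_lagrangeP R n (t - pi / (2 * n%:R)) n0.
  by rewrite !big_add1/= /Q big_split/= => -> ->.
have -> : GK n g t - g t = \sum_(0 <= j < n)
    (n%:R / pi * (\int[mu]_(x in cheb_cell n j) g x) - g t / 2) * Q j.
  under [RHS]eq_bigr do rewrite mulrBl; rewrite sumrB -GKE -mulr_sumr sumQ.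
  by rewrite divfK.
rewrite (le_trans (ler_norm_sum _ _ _))//.
(* A point of cell j is at distance at most (|i - j| + 1) pi / n from t, which lies in cell i. *)
apply: (@le_trans _ _ (\sum_(0 <= j < n)
    (e + K * (((natdist i j)%:R + 1) * (pi / n%:R))) / 2 * cell_weight (natdist i j))).
  apply: ler_sum_nat => j /andP[_ jn]; rewrite normrM ler_pM// ?GK_kernel_le//.
  have mI := @cheb_cell_measurable R n j.
  have icst (c : R) : mu.-integrable (cheb_cell n j) (EFin \o cst c).
    exact: cheb_cell_integrable_cst.
  have igj : mu.-integrable (cheb_cell n j) (EFin \o g) by exact: cell_integrable.
  have -> : n%:R / pi * (\int[mu]_(x in cheb_cell n j) g x) - g t / 2 =
      n%:R / pi * \int[mu]_(x in cheb_cell n j) (g x - g t).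
    rewrite RintegralB//; last exact: icst.
    rewrite Rintegral_cheb_cell_cst// mulrBr; congr (_ - _).
    by have := @pi_gt0 R; move: (@pi R) => a a0; field; rewrite !gt_eqF.
  have ib : mu.-integrable (cheb_cell n j) (EFin \o (fun x => g x - g t)).
    exact: (integrableB mI igj (icst (g t))).
  rewrite normrM (gtr0_norm c0) mulrC -ler_pdivlMr//.
  apply: le_trans (le_normr_Rintegral mI ib) _.
  set M := e + _.
  have -> : M / 2 / (n%:R / pi) = \int[mu]_(x in cheb_cell n j) M.
    by rewrite Rintegral_cheb_cell_cst//; have := @pi_gt0 R; move: (@pi R) => a a0; field; rewrite !gt_eqF.
  apply: le_Rintegral => //; [exact: integrable_norm|exact: icst|].
  move=> x xj; apply: le_trans (modg _ _ (@cheb_cell_sub R n j jn x xj) Dt) _.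
  rewrite lerD2l ler_wpM2l//.
  have /andP[x1 x2] := @cheb_cell_bounds R n j x n0 xj.
  have : 0 < pi / n%:R :> R by rewrite divr_gt0 ?pi_gt0.
  case/andP: ti => t1 t2; move: x1 x2 t1 t2; rewrite -![_.+1%:R]natr1.
  move: (pi / n%:R) => c x1 x2 t1 t2 h0.
  have [ij|ji] := leqP i j.
    have -> : (natdist i j)%:R = j%:R - i%:R :> R by rewrite /natdist (eqP ij) add0n natrB.
    have ij' : i%:R <= j%:R :> R by rewrite ler_nat.
    by rewrite ler_norml; apply/andP; split; nra.
  have -> : (natdist i j)%:R = i%:R - j%:R :> R.
    by rewrite /natdist (eqP (ltnW ji)) addn0 natrB// ltnW.
  have ji' : j%:R <= i%:R :> R by rewrite ler_nat ltnW.
  by rewrite ler_norml; apply/andP; split; nra.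
have s0 : 0 < Num.sqrt n%:R :> R by rewrite sqrtr_gt0.
have -> : \sum_(0 <= j < n)
    (e + K * (((natdist i j)%:R + 1) * (pi / n%:R))) / 2 * cell_weight (natdist i j) =
    e / 2 * (\sum_(0 <= j < n) cell_weight (natdist i j)) +
    K * (pi / n%:R) / 2 *
      (\sum_(0 <= j < n) ((natdist i j)%:R + 1) * cell_weight (natdist i j)).
  rewrite !mulr_sumr -big_split/=; apply: eq_bigr => j _.
  by field; rewrite gt_eqF.
have S1 := @sum_cell_weight R n i i_n; have S2 := @sum_cell_weight_moment R n i i_n.
apply: lerD.
  by rewrite (le_trans (ler_wpM2l _ S1))//; lra.
apply: le_trans (ler_wpM2l _ S2) _.
  by rewrite divr_ge0// mulr_ge0// divr_ge0 ?pi_ge0// ltW.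
have nE : n%:R = Num.sqrt n%:R ^+ 2 :> R by rewrite sqr_sqrtr// ltW.
move: (Num.sqrt n%:R) nE s0 => s -> s0.
by rewrite le_eqVlt; apply/orP; left; apply/eqP; field; rewrite gt_eqF.
Qed.

End convergence.

(** * Density and convergence *)

Section density.
Context {R : realType}.
Notation mu := (@lebesgue_measure R).
Notation D := (`[0, pi]%classic : set (measurableTypeR R)).
Implicit Types (p K e s t x y M : R) (f g u v : R -> R) (i j n : nat).

Lemma nonneg_cvge0P (w : nat -> \bar R) : (forall n, (0 <= w n)%E) ->
  (w n @[n --> \oo] --> 0%E) <->
  (forall e, 0 < e -> \forall n \near \oo, (w n <= e%:E)%E).
Proof.
move=> w0; split=> [/fine_cvgP[fw /cvgrPdist_le cw] e e0|cw].
  near=> n; rewrite -[leLHS]fineK; last by near: n; exact: fw.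
  rewrite lee_fin (le_trans (ler_norm _))// -normrN -sub0r.
  by near: n; exact: cw.
apply/fine_cvgP; split.
  near=> n; rewrite ge0_fin_numE//; apply: le_lt_trans (ltry 1).
  by near: n; exact: cw.
apply/cvgrPdist_le => e e0; near=> n.
have we : (w n <= e%:E)%E by near: n; exact: cw.
rewrite sub0r normrN /= ger0_norm ?fine_ge0// -lee_fin fineK//.
by rewrite ge0_fin_numE// (le_lt_trans we) ?ltry.
Unshelve. all: by end_near. Qed.

Lemma measurable0pi : measurable D.
Proof. exact: measurable_itv. Qed.

Lemma measure0pi : mu D = pi%:E.
Proof. by rewrite lebesgue_measure_itv/= lte_fin pi_gt0 sube0. Qed.

Lemma Lp0pi_normE p f : 1 <= p ->
  Lp0pi_norm p f = ((\int[mu]_(t in D) (`|f t| `^ p)%:E) `^ p^-1)%E.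
Proof.
move=> p1; rewrite /Lp0pi_norm unlock /=; apply: (congr1 (fun z => z `^ p^-1)%E).
rewrite [RHS]integral_mkcond; apply: eq_integral => t _ /=.
rewrite /restrict/= !patchE; case: ifPn => // _.
by rewrite normr0 powR0// gt_eqF//; lra.
Qed.

Lemma Lp0pi_norm_ge0 p f : (0 <= Lp0pi_norm p f)%E.
Proof. exact: Lnorm_ge0. Qed.

Lemma Lp0pi_normB p f g : 1 <= p -> Lp0pi_norm p (f \- g)%R = Lp0pi_norm p (g \- f).
Proof.
move=> p1; rewrite !(Lp0pi_normE _ _ p1); apply: (congr1 (fun z => z `^ p^-1)%E).
by apply: eq_integral => t _ /=; rewrite distrC.
Qed.

Lemma le_Lp0pi_norm p f e : 1 <= p -> 0 <= e ->
  (\int[mu]_(t in D) (`|f t| `^ p)%:E <= (e `^ p)%:E)%E -> (Lp0pi_norm p f <= e%:E)%E.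
Proof.
move=> p1 e0 fe; have p0 : 0 < p by lra.
have -> : e%:E = ((e `^ p)%:E `^ p^-1)%E.
  by rewrite poweR_EFin -powRrM divff ?gt_eqF// powRr1.
rewrite Lp0pi_normE//; apply: gt0_ler_poweR => //; first by rewrite invr_ge0 ltW.
- by rewrite in_itv/= leey andbT; apply: integral_ge0 => t _; rewrite lee_fin powR_ge0.
- by rewrite in_itv/= leey andbT lee_fin powR_ge0.
Qed.

Lemma Lp0pi_normD p f g : 1 <= p -> measurable_fun D f -> measurable_fun D g ->
  (Lp0pi_norm p (f \+ g)%R <= Lp0pi_norm p f + Lp0pi_norm p g)%E.
Proof.
move=> p1 mf mg; rewrite /Lp0pi_norm.
have -> : (f \+ g) \_ D = (f \_ D \+ g \_ D).
  by apply/funext => t; rewrite /= !patchE; case: ifPn => //; rewrite addr0.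
have mr u : measurable_fun D u -> measurable_fun setT (u \_ D).
  by case: (measurable_restrictT u measurable0pi).
by apply: minkowski_EFin => //; exact: mr.
Qed.

Lemma integrable_powR_of_norm p f e : 1 <= p -> measurable_fun D f ->
  (Lp0pi_norm p f <= e%:E)%E -> mu.-integrable D (EFin \o (fun t => `|f t| `^ p)).
Proof.
move=> p1 mf fe; apply/integrableP; split.
  by apply/measurable_EFinP; exact: measurable_norm_powR.
have : (Lp0pi_norm p f < +oo)%E by rewrite (le_lt_trans fe) ?ltry.
have pn : p^-1 != 0 by rewrite invr_eq0 gt_eqF//; lra.
rewrite Lp0pi_normE// => /(lty_poweRy pn); apply: le_lt_trans.
by under eq_integral do rewrite /= ger0_norm ?powR_ge0//.
Qed.

Lemma GK_Lp0pi_norm_le n p u e : (0 < n)%N -> 1 <= p -> 0 <= e ->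
  measurable_fun D u -> mu.-integrable D (EFin \o u) ->
  (Lp0pi_norm p u <= e%:E)%E -> (Lp0pi_norm p (GK n u) <= (384 * e)%:E)%E.
Proof.
move=> n0 p1 e0 um iu ue; have p0 : 0 < p by lra.
have iup := @integrable_powR_of_norm _ _ _ p1 um ue.
have C0 : 0 <= 384 * e by rewrite mulr_ge0 ?ler0n.
apply: (@le_Lp0pi_norm p (GK n u) (384 * e) p1 C0).
apply: le_trans (@GK_powR_integral_le R n p u n0 p1 iu iup) _.
rewrite lee_fin (powRM _ (ler0n _ _) e0) ler_wpM2l ?powR_ge0//.
have I0 : 0 <= \int[mu]_(t in D) `|u t| `^ p.
  by apply: Rintegral_ge0 => t _; exact: powR_ge0.
have IE : (\int[mu]_(t in D) `|u t| `^ p)%:E = (\int[mu]_(t in D) (`|u t| `^ p)%:E)%E.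
  by rewrite fineK//; exact: (integrable_fin_num measurable0pi iup).
move: ue; rewrite Lp0pi_normE// -IE poweR_EFin lee_fin => ue.
have := @ge0_ler_powR _ p (ltW p0) _ _ (powR_ge0 _ _) e0 ue.
by rewrite -powRrM mulVf ?gt_eqF// powRr1.
Qed.

Lemma GKB n f g : mu.-integrable D (EFin \o f) -> mu.-integrable D (EFin \o g) ->
  GK n (f \- g) = GK n f \- GK n g.
Proof.
move=> jf jg; apply/funext => t; rewrite /= !GKE -sumrB; apply: eq_big_nat => j /andP[_ jn].
rewrite -mulrBl -mulrBr RintegralB//; first exact: cheb_cell_measurable.
  exact: cell_integrable.
exact: cell_integrable.
Qed.

Definition GK_converges p f := Lp0pi_norm p (GK n f \- f)%R @[n --> \oo] --> 0%E.

Lemma GK_convergesP p f : GK_converges p f <->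
  forall e, 0 < e -> \forall n \near \oo, (Lp0pi_norm p (GK n f \- f)%R <= e%:E)%E.
Proof. by apply: nonneg_cvge0P => n; exact: Lp0pi_norm_ge0. Qed.

(** The bound 384, uniform in n, makes convergence pass to L^p limits; this serves for the
    truncation and again for the continuous approximation. *)
Lemma GK_converges_closed p f : 1 <= p ->
  measurable_fun D f -> mu.-integrable D (EFin \o f) ->
  (forall e, 0 < e -> exists g, [/\ measurable_fun D g, mu.-integrable D (EFin \o g),
     (Lp0pi_norm p (f \- g)%R <= e%:E)%E & GK_converges p g]) ->
  GK_converges p f.
Proof.
move=> p1 mf jf approx; apply/GK_convergesP => e e0.
(* 770 = 2 (384 + 1): GK_n (f - g) and g - f together use e / 2. *)
have d0 : 0 < e / 770 by apply: divr_gt0; [exact: e0|rewrite ltr0n].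
have [g [mg jg fg /GK_convergesP cg]] := approx _ d0.
have e2 : 0 < e / 2 by apply: divr_gt0; [exact: e0|rewrite ltr0n].
near=> n.
have n0 : (0 < n)%N by near: n; exact: nbhs_infty_gt.
have mGK u : measurable_fun D (GK n u).
  by apply: measurable_funTS; exact: measurable_GK.
have mfg : measurable_fun D (f \- g) by exact: measurable_funB.
have jfg : mu.-integrable D (EFin \o (f \- g)).
  exact: (integrableB measurable0pi jf jg).
have -> : GK n f \- f = GK n (f \- g) \+ ((GK n g \- g) \+ (g \- f)).
  by rewrite GKB//; apply/funext => t /=; ring.
apply: le_trans (@Lp0pi_normD p _ _ p1 _ _) _ => //.
  by apply: measurable_funD; exact: measurable_funB.
apply: (@le_trans _ _ ((384 * (e / 770))%:E + ((e / 2)%:E + (e / 770)%:E))%E).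
  apply: leeD; first exact: (@GK_Lp0pi_norm_le n p _ _ n0 p1 (ltW d0)).
  apply: le_trans (@Lp0pi_normD p _ _ p1 _ _) _; [exact: measurable_funB..|].
  apply: leeD; last by rewrite Lp0pi_normB.
  by near: n; exact: cg.
by rewrite -!EFinD lee_fin; lra.
Unshelve. all: by end_near. Qed.

(** Near a given point, close pairs are handled by continuity; for the others the oscillation 2 M is
    absorbed by a large slope K. Compactness makes K uniform. *)
Lemma bounded_continuous_modulus g M e : continuous g -> (forall x, `|g x| <= M) -> 0 < e ->
  exists2 K, 0 <= K & forall x y, D x -> D y -> `|g x - g y| <= e + K * `|x - y|.
Proof.
move=> cg gM e0; have M0 : 0 <= M := le_trans (normr_ge0 _) (gM 0).
have /compact_near_coveringP cov : compact (`[0, pi]%classic : set R).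
  exact: segment_compact.
have : \forall K \near +oo, `[0, pi]%classic `<=`
    (fun x => 0 <= K /\ forall y, `|g x - g y| <= e + K * `|x - y|).
  apply: cov => x _.
  have e2 : 0 < e / 2 by lra.
  have /cvgrPdist_le/(_ _ e2)/nbhs_ballP[d /= d0 gd] : g z @[z --> x] --> g x by exact: cg.
  near=> z K => /=.
  have K0 : 2 * M / (d / 2) <= K by near: K; apply: nbhs_pinfty_ge; exact: num_real.
  have Kpos : 0 <= K by near: K; apply: nbhs_pinfty_ge; exact: num_real.
  split=> // y.
  have xz : `|x - z| < d / 2 by near: z; apply: nbhsx_ballx; rewrite divr_gt0.
  have [zy|zy] := ltP `|z - y| (d / 2).
    have xd : `|g x - g z| <= e / 2 by apply: gd; rewrite /ball/=; lra.
    have yd : `|g x - g y| <= e / 2.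
      by apply: gd; rewrite /ball/= (le_lt_trans (ler_distD z _ _))//; lra.
    have := ler_distD (g x) (g z) (g y); rewrite (distrC (g z) (g x)).
    have := mulr_ge0 Kpos (normr_ge0 (z - y)); lra.
  have := ler_normB (g z) (g y); have := gM z; have := gM y.
  have : 2 * M <= K * `|z - y|.
    rewrite ler_pdivrMr in K0; last by rewrite divr_gt0.
    by rewrite (le_trans K0)// ler_wpM2l.
  lra.
move=> /filter_ex[K DK]; exists K.
  by have [|//] := DK 0; rewrite /= in_itv/= lexx pi_ge0.
by move=> x y /DK[_ xK] _; exact: xK.
Unshelve. all: by end_near. Qed.

Lemma bounded_integrable f M : measurable_fun D f -> (forall x, `|f x| <= M) ->
  mu.-integrable D (EFin \o f).
Proof.
move=> mf fM; apply: (measurable_bounded_integrable measurable0pi _ mf).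
  by rewrite [X in (X < _)%E]measure0pi ltry.
by exists M; split; [exact: num_real|move=> N /ltW MN x _; exact: le_trans MN].
Qed.

Lemma bounded_continuous_GK_converges p g M : 1 <= p -> continuous g ->
  (forall x, `|g x| <= M) -> GK_converges p g.
Proof.
move=> p1 cg gM; apply/GK_convergesP => e e0.
have mg : measurable_fun D g by apply: measurable_funTS; exact: continuous_measurable_fun.
have jg := @bounded_integrable g M mg gM.
have pi1 : 1 <= pi :> R by have := @pi_ge2 R; lra.
have pi0 := @pi_gt0 R.
(* 192 d is half of the uniform error e / pi; the other half is left to the term in 1 / sqrt n,
   through [sn]. *)
pose d := e / pi / 384.
have p0 : 0 < p by lra.
have ep0 : 0 <= e / pi by rewrite divr_ge0 ?(ltW e0) ?(ltW pi0).
have d0 : 0 < d by apply: divr_gt0; [exact: divr_gt0|rewrite ltr0n].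
have [K K0 gK] := @bounded_continuous_modulus g M _ cg gM d0.
near=> n.
have n0 : (0 < n)%N by near: n; exact: nbhs_infty_gt.
have sn : ((192 * d)^-1 * (384 * K * pi)) ^+ 2 <= n%:R.
  by near: n; exact: nbhs_infty_ger.
have approx t : D t -> `|GK n g t - g t| <= e / pi.
  move=> Dt; apply: le_trans (@GK_approx R n g d K t n0 (ltW d0) K0 Dt jg gK) _.
  have -> : e / pi = 192 * d + 192 * d by rewrite /d; lra.
  have s0 : 0 < Num.sqrt n%:R :> R by rewrite sqrtr_gt0 ltr0n n0.
  have d192 : 0 < 192 * d by rewrite mulr_gt0 ?ltr0n ?d0.
  rewrite lerD2l (ler_pdivrMr _ _ s0) -(ler_pdivrMl _ _ d192).
  have X0 : 0 <= (192 * d)^-1 * (384 * K * pi).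
    have Vd0 : 0 <= (192 * d)^-1 by rewrite invr_ge0 (ltW d192).
    exact: (mulr_ge0 Vd0 (mulr_ge0 (mulr_ge0 (ler0n _ _) K0) (pi_ge0 R))).
  by rewrite -(ger0_norm X0) -sqrtr_sqr; exact: ler_wsqrtr.
apply: (@le_Lp0pi_norm _ _ _ p1 (ltW e0)).
apply: (@le_trans _ _ (\int[mu]_(t in D) ((e / pi) `^ p)%:E)%E).
  apply: (ge0_le_integral _ measurable0pi).
  - by move=> t _; rewrite lee_fin powR_ge0.
  - apply/measurable_EFinP; apply: measurable_norm_powR; apply: measurable_funB; last exact: mg.
    by apply: measurable_funTS; exact: measurable_GK.
  - exact: measurable_cst.
  - by move=> t Dt; rewrite lee_fin ge0_ler_powR ?nnegrE ?normr_ge0 ?ep0 ?(ltW p0) ?approx.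
rewrite integral_cst; last exact: measurable0pi.
rewrite [X in (_ * X)%E]measure0pi -EFinM lee_fin.
have eE : e = e / pi * pi by rewrite divfK ?gt_eqF.
(* What remains is pi <= pi^p, which uses pi >= 1. *)
rewrite [in leRHS]eE (powRM _ ep0 (ltW pi0)).
by rewrite ler_wpM2l ?powR_ge0 ?le1r_powR.
Unshelve. all: by end_near. Qed.

Definition clip M x : R := Num.max (- M) (Num.min M x).

Lemma clip_cases M x : 0 <= M ->
  [\/ (x <= - M /\ clip M x = - M), (- M <= x <= M /\ clip M x = x) |
      (M <= x /\ clip M x = M)].
Proof.
move=> M0; rewrite /clip; have [Mx|xM] := leP M x.
  by constructor 3; split=> //; apply/max_idPr; lra.
have [xM'|Mx'] := leP (- M) x; last by constructor 1; split=> //; exact: ltW.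
by constructor 2; split=> //; rewrite ltW.
Qed.

Lemma clip_norm M x : 0 <= M -> `|clip M x| <= M.
Proof.
move=> M0; case: (@clip_cases M x M0) => -[xM ->]; rewrite ler_norml//;
  by apply/andP; split; lra.
Qed.

Lemma clip_dist M x : 0 <= M -> `|x - clip M x| <= `|x|.
Proof.
move=> M0; case: (@clip_cases M x M0) => -[xM ->]; rewrite ?subrr ?normr0//.
  by rewrite !ler0_norm; lra.
by rewrite !ger0_norm; lra.
Qed.

Lemma clip_lipschitz M x y : 0 <= M -> `|clip M x - clip M y| <= `|x - y|.
Proof.
move=> M0; have := ler_norm (x - y); have := ler_norm (y - x); rewrite distrC => h1 h2.
rewrite ler_norml; apply/andP.
by case: (@clip_cases M x M0) => -[xM ->]; case: (@clip_cases M y M0) => -[yM ->]; split; lra.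
Qed.

Lemma clip_id M x : `|x| <= M -> clip M x = x.
Proof.
move=> xM; have M0 : 0 <= M := le_trans (normr_ge0 _) xM.
move: xM; rewrite ler_norml => /andP[? ?].
by case: (@clip_cases M x M0) => -[? ->]; lra.
Qed.

Lemma measurable_clip M f : measurable_fun D f -> measurable_fun D (clip M \o f).
Proof.
move=> mf; rewrite (_ : clip M \o f = (cst (- M) \max (cst M \min f)))//.
by apply: measurable_maxr => //; exact: measurable_minr.
Qed.

Lemma continuous_clip M g : continuous g -> continuous (clip M \o g).
Proof.
move=> cg; rewrite (_ : clip M \o g = (cst (- M) \max (cst M \min g)))//.
move=> x; apply: continuous_max; first exact: cvg_cst.
by apply: continuous_min; [exact: cvg_cst|exact: cg].
Qed.

End density.

(** * Truncation, continuous approximation and the theorem *)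

Section approximation.
Context {R : realType}.
Notation mu := (@lebesgue_measure R).
Notation D := (`[0, pi]%classic : set (measurableTypeR R)).
Implicit Types (p K e s t x y M : R) (f g u v : R -> R) (i j n : nat).

(** Dominated convergence: the integrand vanishes once n >= |f t| and is dominated by |f|^p. *)
Lemma clip_approx p f e : 1 <= p -> measurable_fun D f ->
  mu.-integrable D (EFin \o (fun t => `|f t| `^ p)) -> 0 < e ->
  exists n, (Lp0pi_norm p (f \- (clip n%:R \o f))%R <= e%:E)%E.
Proof.
move=> p1 mf jf e0; have p0 : 0 < p by lra.
pose h n t := (`|f t - clip n%:R (f t)| `^ p)%:E.
have mh n : measurable_fun D (h n).
  apply/measurable_EFinP; apply: measurable_norm_powR; apply: measurable_funB => //.
  exact: measurable_clip.
have hcvg t : h n t @[n --> \oo] --> 0%E.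
  apply: cvg_near_cst; near=> n; rewrite /h clip_id ?subrr ?normr0 ?powR0 ?gt_eqF//.
  by near: n; exact: nbhs_infty_ger.
have hdom n t : (`|h n t| <= (`|f t| `^ p)%:E)%E.
  rewrite /h gee0_abs ?lee_fin ?powR_ge0// ge0_ler_powR ?nnegrE ?(ltW p0)//.
  exact: clip_dist.
have [] := @dominated_convergence _ _ _ mu D measurable0pi h (cst 0%E)
  (EFin \o (fun t => `|f t| `^ p)) mh (measurable_cst _).
- by apply: aeW => t _; exact: hcvg.
- exact: jf.
- by apply: aeW => t n _; exact: hdom.
move=> _ _; rewrite integral0 => /nonneg_cvge0P => H.
have /filter_ex[n hn] : \forall n \near \oo, (\int[mu]_(t in D) h n t <= (e `^ p)%:E)%E.
  by apply: H; [move=> n; apply: integral_ge0 => t _; rewrite lee_fin powR_ge0|exact: powR_gt0].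
by exists n; exact: (@le_Lp0pi_norm R p _ e p1 (ltW e0)).
Unshelve. all: by end_near. Qed.

(** L^1 approximants are clipped to the bound of [v]. Clipping fixes [v] and is 1-Lipschitz, so it
    brings them no farther from [v], and |v - g|^p <= (2M)^(p-1) |v - g|. *)
Lemma continuous_approx p v M e : 1 <= p -> measurable_fun D v ->
  0 <= M -> (forall x, `|v x| <= M) -> 0 < e ->
  exists g, [/\ continuous g, forall x, `|g x| <= M &
    (Lp0pi_norm p (v \- g)%R <= e%:E)%E].
Proof.
move=> p1 mv M0 vM e0; have p0 : 0 < p by lra.
have jv := @bounded_integrable R v M mv vM.
have Dy : (mu D < +oo)%E by rewrite measure0pi ltry.
have [g_ [cg jg gv]] := approximation_continuous_integrable measurable0pi Dy jv.
pose c := (2 * M) `^ (p - 1).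
have c0 : 0 <= c by exact: powR_ge0.
(* [c] may be 0, hence the denominator c + 1. *)
have d0 : 0 < e `^ p / (c + 1) by rewrite divr_gt0 ?powR_gt0//; lra.
move/nonneg_cvge0P : gv => /(_ (fun n => integral_ge0 _ (fun _ _ => abse_ge0 _))).
move=> /(_ _ d0)/filter_ex[n gn].
exists (clip M \o g_ n); split; [exact: continuous_clip|by move=> x; exact: clip_norm|].
apply: (@le_Lp0pi_norm R p _ e p1 (ltW e0)).
have mg : measurable_fun D (g_ n).
  by apply: measurable_funTS; exact: continuous_measurable_fun.
have md : measurable_fun D (fun t => `|v t - g_ n t|%:E).
  by apply/measurable_EFinP; apply: measurableT_comp => //; exact: measurable_funB.
apply: (@le_trans _ _ (\int[mu]_(t in D) (c%:E * `|v t - g_ n t|%:E))%E).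
  apply: (ge0_le_integral _ measurable0pi).
  - by move=> t _; rewrite lee_fin powR_ge0.
  - apply/measurable_EFinP; apply: measurable_norm_powR; apply: measurable_funB => //.
    exact: measurable_clip.
  - exact: measurable_funeM.
  - move=> t _; rewrite -EFinM lee_fin -[`|_| `^ p]mulr_powRB1// mulrC.
    apply: ler_pM; [exact: powR_ge0|exact: normr_ge0| |].
      rewrite ge0_ler_powR ?nnegrE ?subr_ge0// ?mulr_ge0//.
      rewrite (le_trans (ler_normB _ _))//= (_ : 2 * M = M + M); last by ring.
      by rewrite lerD// clip_norm.
    by rewrite /= -{1}(@clip_id R M _ (vM t)) clip_lipschitz.
rewrite ge0_integralZl_EFin//.
apply: le_trans (lee_wpmul2l _ gn) _; first by rewrite lee_fin.
rewrite -EFinM lee_fin mulrA ler_pdivrMr; last by lra.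
by rewrite mulrC ler_wpM2l ?powR_ge0//; lra.
Qed.

Lemma in_Lp0pi_integrable p f : 1 <= p -> in_Lp0pi p f ->
  [/\ measurable_fun D f, mu.-integrable D (EFin \o f) &
      mu.-integrable D (EFin \o (fun t => `|f t| `^ p))].
Proof.
move=> p1 Lf; have := Lf; rewrite /in_Lp0pi => /[dup] /Lfun_integrable => /(_ p1) jF.
rewrite inE => /andP[]; rewrite inE/= => mF _.
have mf : measurable_fun D f by case: (measurable_restrictT f measurable0pi) => _; exact.
have jf : mu.-integrable D (EFin \o (fun t => `|f t| `^ p)).
  apply: (eq_integrable measurable0pi); last first.
    exact: (integrableS measurableT measurable0pi (@subsetT _ _) jF).
  by move=> t Dt /=; rewrite patchE Dt.
split=> //.
have jc : mu.-integrable D (EFin \o cst (p - 1)).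
  by apply: (@bounded_integrable R (cst (p - 1)) `|p - 1|).
apply: (le_integrable measurable0pi _ _ (integrableD measurable0pi jf jc)).
  exact/measurable_EFinP.
(* The tangent at 1 gives |f| <= p |f| <= |f|^p + (p - 1), integrable on the bounded interval. *)
move=> t _ /=; have := @powR_young R p `|f t| 1 p1 (normr_ge0 _) ler01.
rewrite !powR1 !mulr1 lee_fin => H.
rewrite [leRHS]ger0_norm; last by rewrite addr_ge0 ?powR_ge0// subr_ge0.
apply: le_trans H; rewrite ler_peMl//.
Qed.

End approximation.

Theorem theorem3p5 (R : realType) (p : R) (hp : 1 <= p)
    (f : R -> R) (hf : in_Lp0pi p f) :
  Lp0pi_norm p (GK n f \- f) @[n --> \oo] --> 0%E.
Proof.
have [mf jf jfp] := @in_Lp0pi_integrable R p f hp hf.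
apply: GK_converges_closed => // e e0.
have [N fN] := @clip_approx R p f e hp mf jfp e0.
have mc := @measurable_clip R N%:R f mf.
have cN x : `|(clip N%:R \o f) x| <= N%:R by exact: clip_norm.
have jc := @bounded_integrable R _ _ mc cN.
exists (clip N%:R \o f); split=> //.
(* Second use of closedness, now for the truncated function. *)
apply: GK_converges_closed => // d d0.
have [g [cg gN vg]] := @continuous_approx R p _ N%:R d hp mc (ler0n _ _) cN d0.
have mg : measurable_fun (`[0, pi]%classic : set (measurableTypeR R)) g.
  by apply: measurable_funTS; exact: continuous_measurable_fun.
exists g; split=> //; first exact: (@bounded_integrable R _ _ mg gN).
exact: (@bounded_continuous_GK_converges R p g _ hp cg gN).
Qed.
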